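(* Let $\mathfrak g$ be a compact semisimple Lie algebra with Killing form $\kappa$, regarded as a Poisson manifold with the linear Poisson bracket $\{F,G\}_{\mathfrak g}(L)=\kappa(L,[\nabla F(L),\nabla G(L)])$ and equipped with the pseudo-Riemannian metric $g=\kappa$. Let $S\subset\mathfrak g$ be a regular adjoint orbit, let $\tau^S_{\mathrm{DB}}$ be the double bracket metric on $S$, and let $\nu^S$ be the normal metric on $S$. Then $$\tau^S_{\mathrm{DB}}=-\nu^S .$$
   Context: $\mathfrak g$ is a finite-dimensional real semisimple Lie algebra of compact type, so its Killing form $\kappa$ is negative definite. The gradient $\nabla F(L)\in\mathfrak g$ of $F\in C^\infty(\mathfrak g)$ is taken with respect to $\kappa$: $\kappa(\nabla F(L),X)=\mathrm dF(L)(X)$ for all $X\in\mathfrak g$. The symplectic leaves of the linear Poisson bracket are the adjoint orbits. An element of $\mathfrak g$ is regular if the dimension of its centralizer equals the rank of $\mathfrak g$; a regular adjoint orbit is an adjoint orbit consisting of regular elements. Normal metric: for $L\in S$ there is a $\kappa$-orthogonal decomposition $\mathfrak g=\operatorname{Im}(\operatorname{ad}_L)\oplus\operatorname{Ker}(\operatorname{ad}_L)$, with $T_LS=\operatorname{Im}(\operatorname{ad}_L)=\{[L,X]:X\in\mathfrak g\}$. The normal (standard) metric on $S$ is $$\nu^S([L,X],[L,Y])=-\kappa(X^L,Y^L),\qquad X,Y\in\mathfrak g,$$ where $X^L,Y^L$ denote the components of $X,Y$ in $\operatorname{Im}(\operatorname{ad}_L)$. Double bracket metric: for a Poisson manifold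 $(M,\Pi)$ with pseudo-Riemannian metric $g$, let $\sharp_\Pi\colon T^*M\to TM$ be defined by $\beta(\sharp_\Pi\alpha)=\Pi(\alpha,\beta)$. Let $S$ be a symplectic leaf with inclusion $\iota\colon S\hookrightarrow M$ such that $g^S_{\mathrm{ind}}:=\iota^*g$ is non-degenerate (a good symplectic leaf; here automatic, since $\kappa$ is definite). Let $\omega^S$ be the induced symplectic form on $S$, i.e. $\sharp_\Pi|_S=\iota_*\circ\sharp_{\omega^S}\circ\iota^*$ with $\sharp_{\omega^S}$ the inverse of $X\mapsto i_X\omega^S$ (the opposite sign convention for $\omega^S$ gives the same $\tau^S_{\mathrm{DB}}$). Then $$\tau^S_{\mathrm{DB}}(X,Y):=(g^S_{\mathrm{ind}})^{-1}(i_X\omega^S,i_Y\omega^S),\qquad X,Y\in\mathfrak X(S),$$ where $(g^S_{\mathrm{ind}})^{-1}$ is the co-metric on $T^*S$ associated with $g^S_{\mathrm{ind}}$. *)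

(* Defs.v *)
From HB Require Import structures.
From mathcomp Require Import all_boot all_order all_algebra.
From mathcomp Require Import all_classical all_reals all_analysis.

Set Implicit Arguments.
Unset Strict Implicit.
Unset Printing Implicit Defensive.

Import Order.TTheory GRing.Theory Num.Theory.
Import numFieldNormedType.Exports passmx.

Local Open Scope classical_set_scope.
Local Open Scope ring_scope.

HB.mixin Record isLieAlgebra (R : fieldType) V of Vector R V := {
  lie : V -> V -> V;
  lie_linearl : forall y, linear (lie^~ y);
  lie_linearr : forall x, linear (lie x);
  lie_alt : forall x, lie x x = 0;
  lie_jacobi : forall x y z,
    lie x (lie y z) + lie y (lie z x) + lie z (lie x y) = 0
}.

#[short(type="lieAlgebraType")]
HB.structure Definition LieAlgebra (R : fieldType) :=
  {V of isLieAlgebra R V & Vector R V}.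

(* Throughout, an object that the mathematics specifies by a defining property
   (gradient, bivector, sharp map, ...) is [xget 0 P], i.e. the object
   satisfying [P]; the value 0 is only used if there is none. *)

Section LinearAlgebra.
Variables (R : realType) (V : vectType R).

Definition dual := 'Hom(V, R^o).

(* Bilinear forms, in curried form: [b u] is the covector i_u b = b(u, -). *)
Definition bilin := 'Hom(V, 'Hom(V, R^o)).

Definition vtrace (f : 'End(V)) : R :=
  \tr (mxof (vbasis {:V}) (vbasis {:V}) f).

(* Linear coordinates: the global chart that gives V its topology and its
   smooth structure (both independent of the choice of basis). *)
Definition coords (v : V) : 'rV[R]_(\dim {:V}) := rVof (vbasis {:V}) v.
Definition of_coords (r : 'rV[R]_(\dim {:V})) : V := vecof (vbasis {:V}) r.

(* exp f = \sum_k f^k / k! *)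
Definition lexp (f : 'End(V)) (v : V) : V :=
  of_coords (limn (fun N : nat =>
    coords (\sum_(0 <= k < N) (k`!%:R)^-1 *: iter k f v))).

(* On a nondegenerate [h], [h^-1] is the inverse of the musical isomorphism
   u |-> h(u, -). *)
Definition cometric (h : 'Hom(V, 'Hom(V, R^o))) (a b : dual) : R :=
  h ((h^-1)%VF a) ((h^-1)%VF b).

End LinearAlgebra.

Section Smooth.
Variable R : realType.

(* C^k functions on R^n, through iterated directional derivatives. *)
Fixpoint is_Ck (n k : nat) (f : 'rV[R]_n -> R) : Prop :=
  match k with
  | 0 => continuous f
  | k'.+1 => continuous f /\ (forall x v, derivable f x v) /\
             (forall v, is_Ck k' ('D_v f))
  end.

Variable V : vectType R.

Definition smooth (F : V -> R) : Prop :=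
  forall k, is_Ck k (F \o @of_coords R V).

Definition differential (F : V -> R) (x : V) : dual V :=
  linfun (fun v => 'd (F \o @of_coords R V) (coords x) (coords v)).

End Smooth.

Section PoissonGeometry.
Variables (R : realType) (V : vectType R).

(* The value at x of the bivector field Pi of a Poisson bracket B on V:
   Pi(dF, dG) = B(F, G). *)
Definition bivector (B : (V -> R) -> (V -> R) -> V -> R) (x : V) :
    bilin (dual V) :=
  xget 0 [set P : bilin (dual V) | forall F G, smooth F -> smooth G ->
    P (differential F x) (differential G x) = B F G x].

Definition sharp (P : bilin (dual V)) : 'Hom(dual V, V) :=
  xget 0 [set s : 'Hom(dual V, V) |
    forall alpha beta : dual V, beta (s alpha) = P alpha beta].

Variable T : {vspace V}.

Definition inclusion : 'Hom(subvs_of T, V) := linfun vsval.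

Definition pullback (alpha : dual V) : dual (subvs_of T) :=
  (alpha \o inclusion)%VF.

Definition induced_metric (g : bilin V) : bilin (subvs_of T) :=
  linfun (fun u => pullback (g (inclusion u))).

(* The symplectic form induced by P on a leaf with tangent space T at the
   point: omega inverts a map s with  sharp P = inclusion o s o pullback. *)
Definition leaf_form (P : bilin (dual V)) : bilin (subvs_of T) :=
  xget 0 [set omega : bilin (subvs_of T) |
    exists s : 'Hom(dual (subvs_of T), subvs_of T),
      [/\ cancel s omega, cancel omega s &
          forall alpha : dual V, sharp P alpha = inclusion (s (pullback alpha))]].

Definition double_bracket_form (P : bilin (dual V)) (g : bilin V)
    (u v : subvs_of T) : R :=
  cometric (induced_metric g) (leaf_form P u) (leaf_form P v).

End PoissonGeometry.

Section LieTheory.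
Variables (R : realType) (g : lieAlgebraType R).
Implicit Types (x y L X Y : g) (U W I H : {vspace g}).

Definition ad x : 'End(g) := linfun (lie x).

Definition killing : bilin g :=
  linfun (fun X => linfun (fun Y => vtrace (ad X \o ad Y)%VF : R^o)).

Definition lie_prod U W : {vspace g} :=
  <<[seq lie x y | x <- vbasis U, y <- vbasis W]>>%VS.

Definition lie_ideal I : Prop := forall x y, y \in I -> lie x y \in I.

Definition lie_solvable I : Prop :=
  exists k, iter k (fun U => lie_prod U U) I = 0%VS.

Definition lie_semisimple : Prop :=
  forall I, lie_ideal I -> lie_solvable I -> I = 0%VS.

Definition compact_semisimple : Prop :=
  lie_semisimple /\ forall x, x != 0 -> killing x x < 0.

Definition lie_nilpotent H : Prop := exists k, iter k (lie_prod H) H = 0%VS.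

Definition cartan_subalgebra H : Prop :=
  [/\ {in H &, forall x y, lie x y \in H}, lie_nilpotent H &
      forall x, {in H, forall y, lie x y \in H} -> x \in H].

Definition is_lie_rank (r : nat) : Prop :=
  exists2 H, cartan_subalgebra H & \dim H = r.

Definition centralizer x : {vspace g} := lker (ad x).

Definition regular x : Prop := is_lie_rank (\dim (centralizer x)).

(* The orbit under the adjoint group, i.e. the connected group generated by
   the automorphisms exp(ad X); these are closed under inverse. *)
Definition adjoint_orbit x : set g :=
  [set y | exists Xs : seq g, y = foldr (fun X v => lexp (ad X) v) x Xs].

Definition regular_adjoint_orbit (S : set g) : Prop :=
  (exists x, S = adjoint_orbit x) /\ (forall L, S L -> regular L).

(* T_L S = Im(ad_L), for S the adjoint orbit through L, which is the symplectic
   leaf of the linear Poisson structure through L. *)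
Definition orbit_tangent L : {vspace g} := limg (ad L).

Definition gradient (F : g -> R) L : g :=
  xget 0 [set v : g | forall X, killing v X = differential F L X].

Definition lie_poisson (F G : g -> R) L : R :=
  killing L (lie (gradient F L) (gradient G L)).

Definition double_bracket_metric L :
    subvs_of (orbit_tangent L) -> subvs_of (orbit_tangent L) -> R :=
  double_bracket_form (bivector lie_poisson L) killing.

(* The component X^L of X along g = Im(ad_L) (+) Ker(ad_L). *)
Definition im_component L X : g := daddv_pi (limg (ad L)) (lker (ad L)) X.

(* [vsproj] only casts [L, X], which lies in T_L S, to the type of T_L S. *)
Definition normal_metric L : bilin (subvs_of (orbit_tangent L)) :=
  xget 0 [set nu : bilin (subvs_of (orbit_tangent L)) | forall X Y,
    nu (vsproj (orbit_tangent L) (lie L X)) (vsproj (orbit_tangent L) (lie L Y))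
      = - killing (im_component L X) (im_component L Y)].

End LieTheory.

(* Main.v *)
(** Write [K] for the Killing form, [a#] for the [K]-dual vector of a covector
    [a], and [T = Im (ad L)].  Invariance of [K] gives Pi(a, b) = b [L, a#],
    so sharp a = [L, a#].  Restricted to [T], on which [ad L] is injective and
    [K] is definite, sharp is [ad L] after the inverse of the induced metric;
    hence the leaf form sends [L, t] with t in [T] to the covector K(t, -) of
    [T], and the double bracket metric of [L, s] and [L, t] is K(s, t).  Since
    [L, X] = [L, X^L], this is minus the normal metric. *)
From HB Require Import structures.
Require Import Defs.
From mathcomp Require Import all_boot all_order all_algebra.
From mathcomp Require Import all_classical all_reals all_analysis.
Import Order.TTheory GRing.Theory Num.Theory passmx.
Import numFieldNormedType.Exports.
Local Open Scope ring_scope.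

Set Implicit Arguments.
Unset Strict Implicit.
Unset Printing Implicit Defensive.

Section BilinearMaps.
Variable R : realType.

Lemma linfunE (U V : vectType R) (f : U -> V) : linear f -> linfun f =1 f.
Proof.
move=> lf; pose f' : {linear U -> V} :=
  HB.pack f (GRing.isSemilinear.Build R U V *:%R f (GRing.semilinear_linear lf)).
exact: (lfunE f').
Qed.

Lemma linfun2E (U V W : vectType R) (f : U -> V -> W) :
    (forall y, linear (f^~ y)) -> (forall x, linear (f x)) ->
  forall x y, linfun (fun x => linfun (f x)) x y = f x y.
Proof.
move=> fl fr x y; rewrite linfunE ?linfunE// => a x1 x2.
by apply/lfunP => z; rewrite add_lfunE scale_lfunE !linfunE// fl.
Qed.

End BilinearMaps.

Section LinearFunctionals.
Variables (R : realType) (V : vectType R).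

Lemma row_functional_continuous n (f : {linear 'rV[R]_n -> R^o}) :
  continuous (f : 'rV[R]_n -> R).
Proof.
have -> : (f : 'rV[R]_n -> R) = \sum_i (fun r : 'rV[R]_n => r 0 i * f (delta_mx 0 i)).
  apply/funext => r; rewrite fct_sumE [in LHS](row_sum_delta r) linear_sum.
  by apply: eq_bigr => i _; rewrite linearZ.
move=> r; elim/big_ind : _ => [|g h gr hr|i _]; first exact: cst_continuous.
- exact: continuousD.
- by apply: cvgMr_tmp; [exact: nbhs_filter|exact: (@coord_continuous R 1 n 0 i r)].
Qed.

Lemma is_Ck_cst n k (a : R) : is_Ck k (cst a : 'rV[R]_n -> R).
Proof.
elim: k a => [|k IHk] a /=; first exact: cst_continuous.
split; first exact: cst_continuous.
split=> [x v|v]; first exact: derivable_cst.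
have -> : 'D_v (cst a) = cst 0 :> ('rV[R]_n -> R).
  by apply/funext => x; exact: derive_cst.
exact: IHk.
Qed.

Lemma is_Ck_linear n k (f : {linear 'rV[R]_n -> R^o}) :
  is_Ck k (f : 'rV[R]_n -> R).
Proof.
have cf := @row_functional_continuous n f.
case: k => [|k] //=; split=> //.
have df x : differentiable (f : 'rV[R]_n -> R^o) x.
  exact: linear_differentiable.
split=> [x v|v]; first exact: diff_derivable.
have -> : 'D_v (f : 'rV[R]_n -> R) = cst (f v) :> ('rV[R]_n -> R).
  by apply/funext => x; rewrite (deriveE v (df x)) diff_lin.
exact: is_Ck_cst.
Qed.

Lemma smooth_dual (a : dual V) : smooth a.
Proof.
by move=> k; apply: (is_Ck_linear _ (a \o vecof (vbasis {:V}))).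
Qed.

Lemma differential_dual (a : dual V) x : differential a x = a.
Proof.
pose f : {linear 'rV[R]_(\dim {:V}) -> R^o} := a \o vecof (vbasis {:V}).
have cf := @row_functional_continuous _ f.
rewrite /differential.
have -> : (fun v => 'd (a \o @of_coords R V) (coords x) (coords v)) = a :> (V -> R^o).
  apply/funext => v.
  rewrite (_ : 'd (a \o _) (coords x) = f :> (_ -> _)); last exact: (diff_lin _ cf).
  by rewrite /= /coords rVofK// vbasisP.
by apply/lfunP => v; rewrite lfunE.
Qed.

End LinearFunctionals.

Section DefiniteForms.
Variables (R : realType) (V : vectType R).

Definition anisotropic (b : bilin V) := forall x, x != 0 -> b x x != 0.

Variable b : bilin V.
Hypothesis ab : anisotropic b.

Lemma anisotropic_lker0 : lker b == 0%VS.
Proof.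
apply/lker0P => x y bxy; apply/eqP; rewrite -subr_eq0; apply/negPn/negP => /ab.
have -> : b (x - y) = 0 by rewrite linearB /= bxy subrr.
by rewrite lfunE eqxx.
Qed.

Lemma anisotropic_limg : limg b = fullv.
Proof.
apply/eqP; rewrite eqEdim subvf limg_dim_eq ?(eqP anisotropic_lker0) ?capv0//.
rewrite !dimvf.
have -> : dim (dual V) = (dim V * dim R^o)%N by [].
by rewrite (_ : dim R^o = 1%N)// muln1 leqnn.
Qed.

Lemma anisotropicK : cancel b b^-1%VF.
Proof. exact: lker0_lfunK anisotropic_lker0. Qed.

Lemma anisotropicVK : cancel b^-1%VF b.
Proof. by move=> a; rewrite limg_lfunVK// anisotropic_limg memvf. Qed.

End DefiniteForms.

Section Killing.
Variables (R : realType) (g : lieAlgebraType R).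
Implicit Types (x y z L X Y : g).

Lemma adE x y : ad x y = lie x y.
Proof. exact: linfunE (lie_linearr x) y. Qed.

Lemma ad_linear : linear (@ad R g).
Proof.
move=> a x y; apply/lfunP => z; rewrite add_lfunE scale_lfunE !adE.
by rewrite lie_linearl.
Qed.
HB.instance Definition _ :=
  GRing.isSemilinear.Build R g _ *:%R (@ad R g) (GRing.semilinear_linear ad_linear).

Lemma lieC x y : lie x y = - lie y x.
Proof.
have adD : ad (x + y) = ad x + ad y by rewrite linearD.
have := lie_alt (x + y).
rewrite -adE adD add_lfunE !linearD /= !adE !lie_alt add0r addr0 => /eqP.
by rewrite addr_eq0 => /eqP.
Qed.

Lemma ad_lie x y : ad (lie x y) = (ad x \o ad y)%VF - (ad y \o ad x)%VF.
Proof.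
apply/lfunP => z; rewrite add_lfunE opp_lfunE !comp_lfunE !adE.
have := lie_jacobi x y z.
rewrite (lieC z (lie x y)) (lieC z x) -(adE y (- _)) linearN /= adE => /eqP.
by rewrite subr_eq0 => /eqP.
Qed.

Lemma vtraceC (f h : 'End(g)) : vtrace (f \o h)%VF = vtrace (h \o f)%VF.
Proof. by rewrite /vtrace !(mxof_comp _ _ (vbasisP {:g})) mxtrace_mulC. Qed.

Lemma vtrace_linear : linear (@vtrace R g : 'End(g) -> R^o).
Proof. by move=> a f h; rewrite /vtrace linearP mxtraceD mxtraceZ. Qed.

Lemma vtraceB (f h : 'End(g)) : vtrace (f - h) = vtrace f - vtrace h.
Proof. by rewrite /vtrace !raddfB. Qed.

Lemma killingE X Y : killing g X Y = vtrace (ad X \o ad Y)%VF.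
Proof.
apply: (linfun2E (f := fun X Y : g => vtrace (ad X \o ad Y)%VF : R^o)) =>
    [Z a x y|Z a x y] /=.
  by rewrite linearP comp_lfunDl -comp_lfunZl vtrace_linear.
by rewrite linearP comp_lfunDr -comp_lfunZr vtrace_linear.
Qed.

Lemma killingC X Y : killing g X Y = killing g Y X.
Proof. by rewrite !killingE vtraceC. Qed.

Lemma killing_lie X Y Z : killing g (lie X Y) Z = killing g X (lie Y Z).
Proof.
rewrite !killingE !ad_lie comp_lfunDl comp_lfunDr comp_lfunNl comp_lfunNr.
rewrite !vtraceB -!comp_lfunA; congr (_ - _).
by rewrite [LHS]vtraceC -comp_lfunA.
Qed.

End Killing.

Section AdjointOrbits.
Variables (R : realType) (g : lieAlgebraType R).
Hypothesis hg : compact_semisimple g.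
Implicit Types (x y L X Y : g).

Local Notation K := (killing g).

Lemma killing_anisotropic : anisotropic K.
Proof. by move=> x x0; rewrite lt_eqF// hg.2. Qed.

Lemma killing_inj x y : (forall z, K x z = K y z) -> x = y.
Proof.
by move=> Kxy; apply: (can_inj (anisotropicK killing_anisotropic)); apply/lfunP.
Qed.

Lemma killing_repr (a : dual g) x : K (K^-1%VF a) x = a x.
Proof. by rewrite (anisotropicVK killing_anisotropic). Qed.

Lemma gradientE (F : g -> R) L : gradient F L = K^-1%VF (differential F L).
Proof.
apply: xget_unique => [X|y Ky]; first exact: killing_repr.
by apply: killing_inj => z; rewrite killing_repr Ky.
Qed.

Lemma lie_poissonE (F G : g -> R) L :
  lie_poisson F G L = differential G L (lie L (K^-1%VF (differential F L))).
Proof.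
by rewrite /lie_poisson !gradientE -killing_lie killingC killing_repr.
Qed.

Lemma bivectorE L (a b : dual g) :
  bivector (@lie_poisson R g) L a b = b (lie L (K^-1%VF a)).
Proof.
have /(@xgetPex _ 0) bivectorP : exists P : bilin (dual g),
    forall F G, smooth F -> smooth G ->
    P (differential F L) (differential G L) = lie_poisson F G L.
  exists (linfun (fun a : dual g => linfun (fun b : dual g => b (lie L (K^-1%VF a))))).
  move=> F G _ _; rewrite lie_poissonE.
  apply: (linfun2E (f := fun a b : dual g => b (lie L (K^-1%VF a)))) =>
      [c k x y|c k x y].
    by rewrite -!adE !linearP.
  by rewrite add_lfunE scale_lfunE.
have := bivectorP _ _ (smooth_dual a) (smooth_dual b).
by rewrite lie_poissonE !differential_dual.
Qed.

Lemma sharpE L (a : dual g) :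
  sharp (bivector (@lie_poisson R g) L) a = lie L (K^-1%VF a).
Proof.
set P := bivector _ L.
have /(@xgetPex _ 0) sharpP : exists s : 'Hom(dual g, g),
    forall a b : dual g, b (s a) = P a b.
  by exists (ad L \o K^-1)%VF => c d; rewrite comp_lfunE adE bivectorE.
apply: killing_inj => z; rewrite !(killingC _ z).
by rewrite [LHS]sharpP bivectorE.
Qed.

Section FixedPoint.
Variable L : g.

Local Notation T := (orbit_tangent L).
Local Notation gT := (induced_metric T K).

Lemma ad_cap0 : (T :&: lker (ad L) = 0)%VS.
Proof.
apply/eqP; rewrite -subv0; apply/subvP => z.
rewrite memv_cap memv_ker memv0 adE => /andP[/memv_imgP[w _ zE] /eqP Lz].
apply/negPn/negP => /killing_anisotropic.
by rewrite {2}zE adE -killing_lie lieC Lz oppr0 linear0 lfunE eqxx.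
Qed.

Lemma ad_sum : (T + lker (ad L) = fullv)%VS.
Proof.
apply/eqP; rewrite eqEdim subvf dimv_disjoint_sum ?ad_cap0//.
by rewrite addnC -(limg_ker_dim (ad L) fullv) capfv leqnn.
Qed.

Lemma im_component_tangent X : im_component L X \in T.
Proof. exact: memv_pi. Qed.

Lemma lie_im_component X : lie L (im_component L X) = lie L X.
Proof.
have /= E : _ = X := daddv_pi_add ad_cap0 (_ : X \in _ + _)%VS.
rewrite -{2}E ?ad_sum ?memvf// -2!adE linearD /=.
suff /eqP -> : ad L (daddv_pi (lker (ad L)) T X) == 0 by rewrite addr0.
by rewrite -memv_ker memv_pi.
Qed.

Lemma inclusionE (t : subvs_of T) : inclusion T t = vsval t.
Proof. by rewrite lfunE. Qed.

Lemma induced_metricE (s t : subvs_of T) : gT s t = K (vsval s) (vsval t).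
Proof.
rewrite /induced_metric linfunE; first by rewrite /pullback comp_lfunE !inclusionE.
by move=> k x y; rewrite /pullback !linearP comp_lfunDl -comp_lfunZl.
Qed.

Lemma induced_anisotropic : anisotropic gT.
Proof.
by move=> t t0; rewrite induced_metricE killing_anisotropic.
Qed.

Definition tangent_ad : 'End(subvs_of T) :=
  (linfun (vsproj T) \o (ad L \o inclusion T))%VF.

Lemma tangent_adE t : vsval (tangent_ad t) = lie L (vsval t).
Proof.
by rewrite !comp_lfunE lfunE /= inclusionE vsprojK ?adE// -adE memv_img ?memvf.
Qed.

Lemma tangent_ad_lker0 : lker tangent_ad == 0%VS.
Proof.
rewrite -subv0; apply/subvP => t; rewrite memv_ker memv0 => /eqP At.
have : vsval t \in (T :&: lker (ad L))%VS.
  by rewrite memv_cap memv_ker adE -tangent_adE At subvsP /=.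
by rewrite ad_cap0 memv0 => /eqP t0; apply/eqP/val_inj; rewrite /= t0.
Qed.

Lemma lie_orthogonal x : {in T, forall y, K x y = 0} -> lie L x = 0.
Proof.
move=> Kx; apply: killing_inj => z; rewrite linear0 lfunE /=.
by rewrite lieC linearN opp_lfunE killing_lie Kx ?oppr0// -adE memv_img ?memvf.
Qed.

Lemma leaf_formE t : leaf_form T (bivector (@lie_poisson R g) L) (tangent_ad t) = gT t.
Proof.
set P := bivector _ L.
have /(@xgetPex _ 0)[s [sK _ sharp_s]] : exists omega : bilin (subvs_of T),
    exists s : 'Hom(dual (subvs_of T), subvs_of T),
    [/\ cancel s omega, cancel omega s &
        forall a : dual g, sharp P a = inclusion T (s (pullback T a))].
  have AK := lker0_lfunK tangent_ad_lker0.
  have AVK := lker0_lfunVK tangent_ad_lker0.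
  have gK := anisotropicK induced_anisotropic.
  have gVK := anisotropicVK induced_anisotropic.
  exists (gT \o tangent_ad^-1)%VF, (tangent_ad \o gT^-1)%VF; split=> [b|u|a].
  - by rewrite (comp_lfunE gT) (comp_lfunE tangent_ad) AK gVK.
  - by rewrite (comp_lfunE tangent_ad) (comp_lfunE gT) gK AVK.
  - rewrite sharpE inclusionE (comp_lfunE tangent_ad) tangent_adE; set x := K^-1%VF a.
    set t' := gT^-1%VF _; apply/eqP; rewrite -subr_eq0 -!adE.
    have <- : ad L (x - vsval t') = ad L x - ad L (vsval t') by rewrite linearB.
    rewrite adE.
    apply/eqP/lie_orthogonal => y yT.
    have xy : K x y = a y by rewrite killing_repr.
    have ty : K (vsval t') y = a y.
      by rewrite -(vsprojK yT) -induced_metricE gVK comp_lfunE inclusionE.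
    have -> : K (x - vsval t') = K x - K (vsval t') by rewrite linearB.
    by rewrite add_lfunE opp_lfunE xy ty subrr.
suff -> : tangent_ad t = s (gT t) by exact: sK.
apply: val_inj; rewrite /= tangent_adE -[RHS]inclusionE.
have -> : gT t = pullback T (K (vsval t)).
  by apply/lfunP => v; rewrite induced_metricE comp_lfunE inclusionE.
by rewrite -sharp_s sharpE (anisotropicK killing_anisotropic).
Qed.

Lemma tangent_ad_im_component X :
  tangent_ad (vsproj T (im_component L X)) = vsproj T (lie L X).
Proof.
apply: val_inj; rewrite /= tangent_adE vsprojK ?im_component_tangent//.
by rewrite lie_im_component vsprojK// -adE memv_img ?memvf.
Qed.

Lemma normal_metricE X Y :
  normal_metric L (vsproj T (lie L X)) (vsproj T (lie L Y)) =
    - K (im_component L X) (im_component L Y).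
Proof.
suff /(@xgetPex _ 0) : exists nu : bilin (subvs_of T), forall X Y,
    nu (vsproj T (lie L X)) (vsproj T (lie L Y)) =
      - K (im_component L X) (im_component L Y) by apply.
pose f (u v : subvs_of T) : R^o := - gT (tangent_ad^-1%VF u) (tangent_ad^-1%VF v).
exists (linfun (fun u => linfun (f u))) => {}X {}Y; rewrite linfun2E.
- rewrite /f -!tangent_ad_im_component !(lker0_lfunK tangent_ad_lker0).
  by rewrite induced_metricE !vsprojK ?im_component_tangent.
- by move=> v k x y; rewrite /f !linearP add_lfunE scale_lfunE opprD scalerN.
- by move=> v k x y; rewrite /f !linearP.
Qed.

Lemma double_bracket_metricE (s t : subvs_of T) :
  double_bracket_metric (tangent_ad s) (tangent_ad t) = K (vsval s) (vsval t).
Proof.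
rewrite /double_bracket_metric /double_bracket_form /cometric !leaf_formE.
by rewrite !(anisotropicK induced_anisotropic) induced_metricE.
Qed.

Lemma tangent_lie (u : subvs_of T) : exists X, u = vsproj T (lie L X).
Proof.
have /memv_imgP[X _ uE] := subvsP u.
by exists X; rewrite -adE -uE vsvalK.
Qed.

End FixedPoint.

End AdjointOrbits.

Theorem theorem3p5 (R : realType) (g : lieAlgebraType R)
    (hg : compact_semisimple g)
    (S : set g) (hS : regular_adjoint_orbit S) :
  forall L : g, S L -> forall u v : subvs_of (orbit_tangent L),
    double_bracket_metric u v = - normal_metric L u v.
Proof.
move=> L _ u v; have [[X ->] [Y ->]] := (tangent_lie u, tangent_lie v).
rewrite (normal_metricE hg) opprK -!(tangent_ad_im_component hg).
by rewrite (double_bracket_metricE hg) !vsprojK ?im_component_tangent.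
Qed.
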